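(* Let $n$ be a natural number, and let $F$ be a fixed, arbitrary graph. Let $M$ be the set of all mappings from $K_n$ to $F$ and let $I\subseteq M$ be the set of those mappings which are injective. Then $t(K_n,F)\leq\frac{|I|}{|M|}$.
   Context: All graphs are simple and undirected (no loops, at most one edge between each pair of vertices), finite, and have at least one vertex; natural numbers are positive here. $V(G)$ and $E(G)$ denote the vertex and edge sets of $G$; $K_n$ is the complete graph on $n$ vertices. A mapping $\varphi:G\to F$ between graphs means an arbitrary function $V(G)\to V(F)$, and it is injective if this function is injective. It is a graph homomorphism if $v_1v_2\in E(G)$ implies $\varphi(v_1)\varphi(v_2)\in E(F)$. The homomorphism density is $t(G,F)=\frac{|H|}{|M|}$, where $M$ is the set of all mappings from $G$ to $F$ and $H\subseteq M$ is the set of those that are graph homomorphisms. *)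

(* Defs.v *)
From mathcomp Require Import all_boot all_order all_algebra.

Set Implicit Arguments.
Unset Strict Implicit.
Unset Printing Implicit Defensive.

Import GRing.Theory.
Local Open Scope ring_scope.

Record sgraph := SGraph {
  vertex :> finType;
  edge : rel vertex;
  edge_sym : symmetric edge;
  edge_irrefl : irreflexive edge;
  vertex_gt0 : (0 < #|vertex|)%N
}.

Lemma neq_sym (T : eqType) : symmetric (fun x y : T => x != y).
Proof. by move=> x y; rewrite eq_sym. Qed.

Lemma neq_irrefl (T : eqType) : irreflexive (fun x y : T => x != y).
Proof. by move=> x; rewrite eqxx. Qed.

Lemma card_ord_gt0 n : (0 < n)%N -> (0 < #|'I_n|)%N.
Proof. by rewrite card_ord. Qed.

Definition complete_graph (n : nat) (n_gt0 : (0 < n)%N) : sgraph :=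
  SGraph (@neq_sym 'I_n) (@neq_irrefl 'I_n) (card_ord_gt0 n_gt0).

Definition mappings (G F : sgraph) : {set {ffun G -> F}} := setT.

Definition is_hom (G F : sgraph) (f : {ffun G -> F}) : bool :=
  [forall v1, forall v2, edge v1 v2 ==> edge (f v1) (f v2)].

Definition homs (G F : sgraph) : {set {ffun G -> F}} :=
  [set f in mappings G F | is_hom f].

Definition injections (G F : sgraph) : {set {ffun G -> F}} :=
  [set f in mappings G F | injectiveb f].

Definition hom_density (G F : sgraph) : rat :=
  #|homs G F|%:R / #|mappings G F|%:R.

(* Main.v *)
Require Import Defs.
From mathcomp Require Import all_boot all_order all_algebra.
Local Open Scope ring_scope.

(** In a complete graph distinct vertices are adjacent, so a homomorphism
    sends them to adjacent vertices, which are distinct because the target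
    has no loops. *)
Lemma homs_complete_sub_injections (n : nat) (n_gt0 : (0 < n)%N) (F : sgraph) :
  homs (complete_graph n_gt0) F \subset injections (complete_graph n_gt0) F.
Proof.
apply/subsetP => f; rewrite !inE /= => /forallP hom_f.
apply/injectiveP => u v eq_fuv; apply/eqP; apply/negPn/negP => neq_uv.
have /forallP/(_ v)/implyP/(_ neq_uv) := hom_f u.
by rewrite eq_fuv edge_irrefl.
Qed.

Theorem theorem2p4 (n : nat) (n_gt0 : (0 < n)%N) (F : sgraph) :
  hom_density (complete_graph n_gt0) F <=
    #|injections (complete_graph n_gt0) F|%:R
      / #|mappings (complete_graph n_gt0) F|%:R.
Proof.
rewrite /hom_density Num.Theory.ler_wpM2r ?Num.Theory.invr_ge0 ?Num.Theory.ler0n //.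
by rewrite Num.Theory.ler_nat subset_leq_card // homs_complete_sub_injections.
Qed.
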